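(* Let $(\mathcal{E},\otimes)$ be a locally subcartesian category with pullbacks. This structure is locally subcartesian closed if and only if for every morphism $p$ of $\mathcal{E}$ the affine base change functor $\nabla_p$ has a right adjoint $\boxtimes_p$.
   Context: A commuting square $fg'=gf'$ on a cospan $f\colon A\to X$, $g\colon B\to X$ is subcartesian if the pair $(g',f')$ is jointly monic. A locally subcartesian category $(\mathcal{E},\otimes)$ is a category $\mathcal{E}$ with, for each cospan $f\colon A\to X$, $g\colon B\to X$, a chosen subcartesian square with apex $A\otimes_X B$ and projections $g'\colon A\otimes_X B\to A$, $f'\colon A\otimes_X B\to B$, subject to: (symmetry) there are isomorphisms $A\otimes_X B\cong B\otimes_X A$ commuting with the projections; (nullary) if $g$ is an identity then so is $g'$; (binary) for $p\colon W\to Y$, $q\colon Y\to Z$, $g\colon B\to Z$, with $g'\colon Y\otimes_Z B\to Y$, pasting the chosen square of $(p,g')$ with the chosen square of $(q,g)$ gives a square isomorphic, compatibly with the projections to $W$ and $B$, to the chosen square of $(qp,g)$. For $f\colon X\to Y$, $\Sigma_f\colon\mathcal{E}/X\to\mathcal{E}/Y$ is composition with $f$, and $\nabla_f\colon\mathcal{E}/Y\to\mathcal{E}/X$ sends $h\colon H\to Y$ to the projection $X\otimes_Y H\to X$ and sends $u\colon h\to h_1$ to the unique morphism $X\otimes_Y H\to X\otimes_Y H_1$ over $X$ compatible with $u$ and the projections to $H,H_1$. Each slice $\mathcal{E}/X$ is a monoidal category with tensor $f\otimes_X g=\Sigma_g\nabla_g(f)$ and unit $\mathrm{id}_X$. A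 locally subcartesian category with pullbacks is locally subcartesian closed if for every $X$ this monoidal structure on $\mathcal{E}/X$ is right closed, i.e. for every $g\in\mathcal{E}/X$ the functor $(-)\otimes_X g\colon\mathcal{E}/X\to\mathcal{E}/X$ has a right adjoint. *)

(* Defs.v *)
From Stdlib Require Import ClassicalEpsilon ProofIrrelevance.

Set Implicit Arguments.
Unset Strict Implicit.
Unset Printing Implicit Defensive.

Record category : Type := Category {
  ob :> Type;
  hom : ob -> ob -> Type;
  idm : forall A, hom A A;
  comp : forall A B C, hom B C -> hom A B -> hom A C;
  comp_idl : forall A B (f : hom A B), comp (idm B) f = f;
  comp_idr : forall A B (f : hom A B), comp f (idm A) = f;
  comp_assoc : forall A B C D (h : hom C D) (g : hom B C) (f : hom A B),
    comp h (comp g f) = comp (comp h g) f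
}.

Arguments hom {_} _ _.
Arguments idm {_} _.
Arguments comp {_ _ _ _} _ _.

Declare Scope category_scope.
Delimit Scope category_scope with cat.
Local Open Scope category_scope.
Notation "g ∘ f" := (comp g f) (at level 40, left associativity) : category_scope.

Record functor (C D : category) : Type := Functor {
  fobj :> C -> D;
  fmap : forall A B : C, hom A B -> hom (fobj A) (fobj B);
  fmap_id : forall A : C, fmap (idm A) = idm (fobj A);
  fmap_comp : forall (A B E : C) (g : hom B E) (f : hom A B),
    fmap (g ∘ f) = fmap g ∘ fmap f
}.

Arguments fmap {_ _} _ {_ _} _.

Definition functor_comp (C D E : category) (G : functor D E) (F : functor C D) :
  functor C E.
Proof.
refine (@Functor C E (fun A => G (F A)) (fun A B u => fmap G (fmap F u)) _ _).
- intros A; now rewrite !fmap_id.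
- intros A B K g f; now rewrite !fmap_comp.
Defined.

(* Hom-set form: a bijection [hom (F A) B ~ hom A (G B)] natural in [A] and [B]. *)
Record adjunction (C D : category) (F : functor C D) (G : functor D C) : Type :=
  Adjunction {
  transpose : forall (A : C) (B : D), hom (F A) B -> hom A (G B);
  untranspose : forall (A : C) (B : D), hom A (G B) -> hom (F A) B;
  transposeK : forall A B (u : hom (F A) B), untranspose (transpose u) = u;
  untransposeK : forall A B (v : hom A (G B)), transpose (untranspose v) = v;
  transpose_natural : forall (A A' : C) (B B' : D)
    (a : hom A' A) (u : hom (F A) B) (b : hom B B'),
    transpose (b ∘ u ∘ fmap F a) = fmap G b ∘ transpose u ∘ a
}.

Definition has_right_adjoint (C D : category) (F : functor C D) : Prop :=
  exists G : functor D C, inhabited (adjunction F G).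

Definition is_iso (C : category) (A B : C) (f : hom A B) : Prop :=
  exists g : hom B A, g ∘ f = idm A /\ f ∘ g = idm B.

(* The inductive family lets one say that [f : hom A B] is an identity, which
   includes [A = B], without transporting along an equality of objects. *)
Inductive is_identity (C : category) : forall A B : C, hom A B -> Prop :=
  IsIdentity : forall A : C, is_identity (idm A).

Definition jointly_monic (C : category) (P A B : C) (a : hom P A) (b : hom P B) :
  Prop :=
  forall (T : C) (u v : hom T P), a ∘ u = a ∘ v -> b ∘ u = b ∘ v -> u = v.

(* For the cospan [f : A -> X], [g : B -> X], [pr1] and [pr2] are the morphisms
   usually written [g'] and [f']. *)
Record square (C : category) (A B X : C) (f : hom A X) (g : hom B X) : Type :=
  Square {
  apex : C;
  pr1 : hom apex A;
  pr2 : hom apex B;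
  square_comm : f ∘ pr1 = g ∘ pr2
}.

Definition subcartesian (C : category) (A B X : C) (f : hom A X) (g : hom B X)
  (s : square f g) : Prop := jointly_monic (pr1 s) (pr2 s).

Definition is_pullback (C : category) (A B X : C) (f : hom A X) (g : hom B X)
  (s : square f g) : Prop :=
  forall (T : C) (a : hom T A) (b : hom T B), f ∘ a = g ∘ b ->
    exists! u : hom T (apex s), pr1 s ∘ u = a /\ pr2 s ∘ u = b.

Definition has_pullbacks (C : category) : Prop :=
  forall (A B X : C) (f : hom A X) (g : hom B X),
    exists s : square f g, is_pullback s.

Definition square_iso (C : category) (A B X : C) (f : hom A X) (g : hom B X)
  (s t : square f g) : Prop :=
  exists i : hom (apex s) (apex t),
    is_iso i /\ pr1 t ∘ i = pr1 s /\ pr2 t ∘ i = pr2 s.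

Definition flip_square (C : category) (A B X : C) (f : hom A X) (g : hom B X)
  (s : square f g) : square g f :=
  Square (eq_sym (square_comm s)).

Definition paste_square (C : category) (W Y Z B : C)
  (p : hom W Y) (q : hom Y Z) (g : hom B Z)
  (s : square q g) (t : square p (pr1 s)) : square (q ∘ p) g.
Proof.
refine (@Square C W B Z (q ∘ p) g (apex t) (pr1 t) (pr2 s ∘ pr2 t) _).
now rewrite <- comp_assoc, (square_comm t), !comp_assoc, (square_comm s).
Defined.

Record locally_subcartesian (C : category) : Type := LocallySubcartesian {
  lsq : forall (A B X : C) (f : hom A X) (g : hom B X), square f g;
  lsq_subcartesian : forall (A B X : C) (f : hom A X) (g : hom B X),
    subcartesian (lsq f g);
  lsq_symmetry : forall (A B X : C) (f : hom A X) (g : hom B X),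
    square_iso (lsq f g) (flip_square (lsq g f));
  lsq_nullary : forall (A B X : C) (f : hom A X) (g : hom B X),
    is_identity g -> is_identity (pr1 (lsq f g));
  lsq_binary : forall (W Y Z B : C) (p : hom W Y) (q : hom Y Z) (g : hom B Z),
    square_iso (paste_square (lsq p (pr1 (lsq q g)))) (lsq (q ∘ p) g)
}.

Arguments lsq {_} _ {_ _ _} _ _.
Arguments lsq_subcartesian {_} _ {_ _ _} _ _ _ _ _ _ _.

Record slice_ob (C : category) (X : C) : Type := SliceOb {
  slice_dom : C;
  slice_arr : hom slice_dom X
}.

Record slice_hom (C : category) (X : C) (a b : slice_ob X) : Type := SliceHom {
  slice_map : hom (slice_dom a) (slice_dom b);
  slice_comm : slice_arr b ∘ slice_map = slice_arr a
}.

Lemma slice_hom_eq (C : category) (X : C) (a b : slice_ob X) (u v : slice_hom a b) :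
  slice_map u = slice_map v -> u = v.
Proof.
destruct u as [u hu], v as [v hv]; simpl; intros e; subst v.
now rewrite (proof_irrelevance _ hu hv).
Qed.

Definition slice_id (C : category) (X : C) (a : slice_ob X) : slice_hom a a :=
  SliceHom (comp_idr (slice_arr a)).

Definition slice_comp (C : category) (X : C) (a b c : slice_ob X)
  (v : slice_hom b c) (u : slice_hom a b) : slice_hom a c.
Proof.
refine (@SliceHom C X a c (slice_map v ∘ slice_map u) _).
now rewrite comp_assoc, (slice_comm v), (slice_comm u).
Defined.

Definition slice (C : category) (X : C) : category.
Proof.
refine (@Category (slice_ob X) (@slice_hom C X) (@slice_id C X) (@slice_comp C X)
          _ _ _).
- intros a b u; apply slice_hom_eq, comp_idl.
- intros a b u; apply slice_hom_eq, comp_idr.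
- intros a b c d w v u; apply slice_hom_eq, comp_assoc.
Defined.

Definition Sigma_map (C : category) (X Y : C) (f : hom X Y) (a b : slice_ob X)
  (u : slice_hom a b) :
  slice_hom (SliceOb (f ∘ slice_arr a)) (SliceOb (f ∘ slice_arr b)).
Proof.
refine (@SliceHom C Y (SliceOb (f ∘ slice_arr a)) (SliceOb (f ∘ slice_arr b))
          (slice_map u) _).
now simpl; rewrite <- comp_assoc, (slice_comm u).
Defined.

Definition Sigma (C : category) (X Y : C) (f : hom X Y) :
  functor (slice X) (slice Y).
Proof.
refine (@Functor (slice X) (slice Y) (fun a : slice_ob X => SliceOb (f ∘ slice_arr a))
          (@Sigma_map C X Y f) _ _).
- intros a; now apply slice_hom_eq.
- intros a b c v u; now apply slice_hom_eq.
Defined.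

(* The unique morphism exists by the binary axiom applied to
   [slice_map u], [slice_arr h1], [f], conjugated by the symmetry. *)
Lemma nabla_map_exists (C : category) (S : locally_subcartesian C) (X Y : C)
  (f : hom X Y) (h h1 : slice_ob Y) (u : slice_hom h h1) :
  exists! m : hom (apex (lsq S f (slice_arr h))) (apex (lsq S f (slice_arr h1))),
    pr1 (lsq S f (slice_arr h1)) ∘ m = pr1 (lsq S f (slice_arr h)) /\
    pr2 (lsq S f (slice_arr h1)) ∘ m = slice_map u ∘ pr2 (lsq S f (slice_arr h)).
Proof.
destruct h as [H h], h1 as [H1 h1], u as [u hu]; simpl in *; subst h.
destruct (lsq_symmetry S f (h1 ∘ u)) as [i [_ [i1 i2]]].
destruct (lsq_binary S u h1 f) as [j [[k [_ jk]] [j1 j2]]].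
destruct (lsq_symmetry S h1 f) as [l [_ [l1 l2]]].
simpl in *.
set (m0 := l ∘ (pr2 (lsq S u (pr1 (lsq S h1 f))) ∘ (k ∘ i))).
assert (e1 : pr1 (lsq S f h1) ∘ m0 = pr1 (lsq S f (h1 ∘ u))).
{ unfold m0; rewrite !comp_assoc, l2, <- j2, <- (comp_assoc _ j k), jk, comp_idr.
  exact i1. }
assert (e2 : pr2 (lsq S f h1) ∘ m0 = u ∘ pr2 (lsq S f (h1 ∘ u))).
{ unfold m0; rewrite !comp_assoc, l1.
  rewrite <- (square_comm (lsq S u (pr1 (lsq S h1 f)))), <- j1.
  now rewrite <- !comp_assoc, (comp_assoc j), jk, comp_idl, i2. }
exists m0; split; [now split|].
intros m [m1 m2]; apply (lsq_subcartesian S f h1).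
- now rewrite e1, m1.
- now rewrite e2, m2.
Qed.

Definition nabla_ob (C : category) (S : locally_subcartesian C) (X Y : C)
  (f : hom X Y) (h : slice_ob Y) : slice_ob X :=
  SliceOb (pr1 (lsq S f (slice_arr h))).

Definition nabla_map (C : category) (S : locally_subcartesian C) (X Y : C)
  (f : hom X Y) (h h1 : slice_ob Y) (u : slice_hom h h1) :
  slice_hom (nabla_ob S f h) (nabla_ob S f h1) :=
  let m := constructive_definite_description _ (nabla_map_exists S f u) in
  @SliceHom C X (nabla_ob S f h) (nabla_ob S f h1) (proj1_sig m)
    (proj1 (proj2_sig m)).

Lemma nabla_map_pr2 (C : category) (S : locally_subcartesian C) (X Y : C)
  (f : hom X Y) (h h1 : slice_ob Y) (u : slice_hom h h1) :
  pr2 (lsq S f (slice_arr h1)) ∘ slice_map (nabla_map S f u) =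
  slice_map u ∘ pr2 (lsq S f (slice_arr h)).
Proof.
exact (proj2 (proj2_sig
  (constructive_definite_description _ (nabla_map_exists S f u)))).
Qed.

Lemma nabla_hom_eq (C : category) (S : locally_subcartesian C) (X Y : C)
  (f : hom X Y) (k : slice_ob X) (h : slice_ob Y)
  (u v : slice_hom k (nabla_ob S f h)) :
  pr2 (lsq S f (slice_arr h)) ∘ slice_map u =
  pr2 (lsq S f (slice_arr h)) ∘ slice_map v -> u = v.
Proof.
intros e; apply slice_hom_eq, (lsq_subcartesian S f (slice_arr h)); [|exact e].
exact (eq_trans (slice_comm u) (eq_sym (slice_comm v))).
Qed.

Definition nabla (C : category) (S : locally_subcartesian C) (X Y : C)
  (f : hom X Y) : functor (slice Y) (slice X).
Proof.
refine (@Functor (slice Y) (slice X) (nabla_ob S f) (@nabla_map C S X Y f) _ _).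
- intros h; apply nabla_hom_eq; rewrite nabla_map_pr2; simpl.
  now rewrite comp_idl, comp_idr.
- intros h h1 h2 v u; apply nabla_hom_eq; rewrite nabla_map_pr2.
  symmetry; etransitivity; [apply comp_assoc|].
  etransitivity; [apply (f_equal (fun m => m ∘ _) (nabla_map_pr2 S f v))|].
  rewrite <- comp_assoc.
  etransitivity; [apply (f_equal (fun m => _ ∘ m) (nabla_map_pr2 S f u))|].
  apply comp_assoc.
Defined.

(* The functor [(-) ⊗_X g], whose value at [f] is [Σ_g (∇_g f)]. *)
Definition slice_tensor_right (C : category) (S : locally_subcartesian C) (X : C)
  (g : slice X) : functor (slice X) (slice X) :=
  functor_comp (Sigma (slice_arr g)) (nabla S (slice_arr g)).

Definition locally_subcartesian_closed (C : category) (S : locally_subcartesian C) :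
  Prop :=
  forall (X : C) (g : slice X), has_right_adjoint (slice_tensor_right S g).

(* Main.v *)
From Stdlib Require Import ClassicalEpsilon.
Require Import Defs.

(** If [∇_g ⊣ ⊠_g], then composing with [Σ_g ⊣ Δ_g], where [Δ_g] is pullback
    along [g], gives [Σ_g ∇_g ⊣ ⊠_g Δ_g].  Conversely, let [R] be right adjoint
    to [Σ_p ∇_p].  A morphism [∇_p h -> k] over [X] is a morphism
    [Σ_p ∇_p h -> Σ_p k] over [Y] whose composite with [k : Σ_p k -> p] is the
    projection [Σ_p ∇_p h -> p], and this projection factors through
    [Σ_p ∇_p id_Y].  Hence [⊠_p k] is the pullback of [R k : R (Σ_p k) -> R p]
    along the transpose [id_Y -> R p] of [Σ_p ∇_p id_Y -> p]. *)

Local Open Scope category_scope.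

(** This makes [eps] a terminal object of the comma category of [F] over [B]: one component of a
    counit, stated without a functor [G]. *)
Definition couniversal (C D : category) (F : functor C D) (B : D) (G : C)
  (eps : hom (F G) B) : Prop :=
  forall (A : C) (u : hom (F A) B), exists! v : hom A G, eps ∘ fmap F v = u.

Arguments couniversal {C D} F {B G} eps.

Lemma couniversal_inj (C D : category) (F : functor C D) (B : D) (G : C)
  (eps : hom (F G) B) : couniversal F eps ->
  forall (A : C) (v w : hom A G), eps ∘ fmap F v = eps ∘ fmap F w -> v = w.
Proof.
intros He A v w e; destruct (He A (eps ∘ fmap F w)) as [x [_ xu]].
now rewrite <- (xu v e), <- (xu w eq_refl).
Qed.

(** Allows right adjoints to be built one object at a time: after choosing couniversal arrows,
    uniqueness of factorizations forces functoriality and naturality. *)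
Lemma has_right_adjoint_couniversal (C D : category) (F : functor C D) :
  has_right_adjoint F <->
  forall B : D, exists (G : C) (eps : hom (F G) B), couniversal F eps.
Proof.
split.
- intros [G [adj]] B.
  exists (G B), (untranspose adj (idm (G B))).
  assert (key : forall A (v : hom A (G B)),
    transpose adj (untranspose adj (idm (G B)) ∘ fmap F v) = v).
  { intros A v.
    rewrite <- (comp_idl (untranspose adj _)), (transpose_natural adj).
    now rewrite untransposeK, fmap_id, !comp_idl. }
  intros A u; exists (transpose adj u); split.
  + now rewrite <- (transposeK adj (_ ∘ _)), key, transposeK.
  + intros v <-; apply key.
- intros H.
  assert (H' : forall B, {G : C & {eps : hom (F G) B | couniversal F eps}}).
  { intros B.
    destruct (constructive_indefinite_description _ (H B)) as [G HG].
    exists G; exact (constructive_indefinite_description _ HG). }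
  set (G0 := fun B => projT1 (H' B)).
  set (eps := fun B => proj1_sig (projT2 (H' B)) : hom (F (G0 B)) B).
  set (tr := fun A B (u : hom (F A) B) => proj1_sig
    (constructive_definite_description _ (proj2_sig (projT2 (H' B)) A u))
    : hom A (G0 B)).
  assert (tr_eq : forall A B (u : hom (F A) B), eps B ∘ fmap F (tr A B u) = u).
  { intros A B u; unfold tr.
    now destruct (constructive_definite_description _ _). }
  assert (eps_inj : forall A B (v w : hom A (G0 B)),
    eps B ∘ fmap F v = eps B ∘ fmap F w -> v = w).
  { intros A B; apply couniversal_inj, proj2_sig. }
  (* From here on every equation is checked after applying [eps], through [tr_eq] and [eps_inj]. *)
  clearbody tr eps.
  unshelve epose (G := @Functor D C G0 (fun A B b => tr _ _ (b ∘ eps A)) _ _).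
  { intros A; apply eps_inj; now rewrite tr_eq, fmap_id, comp_idl, comp_idr. }
  { intros A B K g f; apply eps_inj.
    now rewrite fmap_comp, comp_assoc, !tr_eq, <- !comp_assoc, tr_eq. }
  exists G; constructor.
  refine (@Adjunction C D F G tr (fun A B v => eps B ∘ fmap F v) tr_eq _ _).
  + intros A B v; apply eps_inj, tr_eq.
  + intros A A' B B' a u b; apply eps_inj; simpl.
    rewrite tr_eq, !fmap_comp, !comp_assoc, tr_eq.
    now rewrite <- (comp_assoc b (eps B)), tr_eq.
Qed.

Lemma has_right_adjoint_comp (C D K : category) (G : functor D K) (F : functor C D) :
  has_right_adjoint G -> has_right_adjoint F ->
  has_right_adjoint (functor_comp G F).
Proof.
rewrite !has_right_adjoint_couniversal; intros HG HF B.
destruct (HG B) as [M [eps He]], (HF M) as [N [eta Hn]].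
exists N, (eps ∘ fmap G eta); intros A u; simpl.
destruct (He _ u) as [v [ev uv]], (Hn _ v) as [w [ew uw]].
exists w; split.
- now rewrite <- comp_assoc, <- fmap_comp, ew.
- intros w' e; apply uw; symmetry; apply uv.
  now rewrite fmap_comp, comp_assoc.
Qed.

(** The right adjoint is pullback along [f]; the counit at [b] is the projection [pr2] of the
    pullback. *)
Lemma Sigma_has_right_adjoint (C : category) (X Y : C) (f : hom X Y) :
  has_pullbacks C -> has_right_adjoint (Sigma f).
Proof.
intros pb; apply has_right_adjoint_couniversal; intros [B b].
destruct (pb _ _ _ f b) as [s Hs].
exists (SliceOb (pr1 s)).
exists (@SliceHom C Y (SliceOb (f ∘ pr1 s)) (SliceOb b) (pr2 s)
  (eq_sym (square_comm s))).
intros [A a] [u hu]; simpl in *.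
destruct (Hs A a u (eq_sym hu)) as [v [[v1 v2] vu]].
exists (@SliceHom C X (SliceOb a) (SliceOb (pr1 s)) v v1); split.
- now apply slice_hom_eq.
- intros [w hw] e; apply slice_hom_eq; simpl in *; apply vu; split; [exact hw|].
  exact (f_equal (@slice_map _ _ _ _) e).
Qed.

Lemma slice_has_pullbacks (C : category) (X : C) :
  has_pullbacks C -> has_pullbacks (slice X).
Proof.
intros pb A B Z f g.
destruct (pb _ _ _ (slice_map f) (slice_map g)) as [s Hs].
assert (e : slice_arr B ∘ pr2 s = slice_arr A ∘ pr1 s).
{ rewrite <- (slice_comm f), <- (slice_comm g), <- !comp_assoc.
  now rewrite (square_comm s). }
set (P := SliceOb (slice_arr A ∘ pr1 s)).
unshelve eexists.
{ refine (@Square (slice X) A B Z f g P (@SliceHom C X P A (pr1 s) eq_refl)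
    (@SliceHom C X P B (pr2 s) e) _).
  apply slice_hom_eq, (square_comm s). }
intros T a b ab; simpl.
destruct (Hs _ (slice_map a) (slice_map b) (f_equal (@slice_map _ _ _ _) ab))
  as [v [[v1 v2] vu]].
unshelve eexists.
{ refine (@SliceHom C X T P v _); simpl.
  rewrite <- comp_assoc, v1; exact (slice_comm a). }
split.
- split; now apply slice_hom_eq.
- intros w [w1 w2]; apply slice_hom_eq; simpl; apply vu; split.
  + exact (f_equal (@slice_map _ _ _ _) w1).
  + exact (f_equal (@slice_map _ _ _ _) w2).
Qed.

Definition terminal (C : category) (one : C) : Prop :=
  forall A : C, exists! u : hom A one, True.

Arguments terminal {C} one.

Lemma slice_terminal (C : category) (X : C) :
  terminal (SliceOb (idm X) : slice X).
Proof.
intros A.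
exists (@SliceHom C X A (SliceOb (idm X)) (slice_arr A) (comp_idl _)).
split; [exact I|]; intros v _; apply slice_hom_eq; simpl.
now rewrite <- (slice_comm v); simpl; rewrite comp_idl.
Qed.

(** Up to [p ∘ idm X = p], this is the image under [Sigma p] of the unique morphism from [a] to the
    identity of [X]. *)
Definition Sigma_proj (C : category) (X Y : C) (p : hom X Y) (a : slice X) :
  @hom (slice Y) (Sigma p a) (SliceOb p) :=
  @SliceHom C Y (SliceOb (p ∘ slice_arr a)) (SliceOb p) (slice_arr a) eq_refl.

Arguments Sigma_proj {C X Y} p a.

Lemma Sigma_proj_natural (C : category) (X Y : C) (p : hom X Y) (a b : slice X)
  (u : hom a b) : Sigma_proj p b ∘ fmap (Sigma p) u = Sigma_proj p a.
Proof. apply slice_hom_eq; exact (slice_comm u). Qed.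

Lemma Sigma_faithful (C : category) (X Y : C) (p : hom X Y) (a b : slice X)
  (u v : hom a b) : fmap (Sigma p) u = fmap (Sigma p) v -> u = v.
Proof.
intros e; apply slice_hom_eq; exact (f_equal (@slice_map _ _ _ _) e).
Qed.

(** With [Sigma_faithful], this gives the hom-sets of [slice X] as those of the slice of [slice Y]
    over [SliceOb p]. *)
Lemma Sigma_lift (C : category) (X Y : C) (p : hom X Y) (a b : slice X)
  (f : hom (Sigma p a) (Sigma p b)) :
  Sigma_proj p b ∘ f = Sigma_proj p a ->
  exists u : hom a b, fmap (Sigma p) u = f.
Proof.
intros e.
exists (@SliceHom C X a b (slice_map f) (f_equal (@slice_map _ _ _ _) e)).
now apply slice_hom_eq.
Qed.

(** A morphism [F A -> k] is a morphism between the images under [Sigma p] that respects the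
    projections to [SliceOb p]. Transposing turns this condition into a commuting square on the
    cospan [r], [t], hence into a map to its pullback. *)
Lemma has_right_adjoint_of_Sigma_comp (C D : category) (one : C) (X Y : D)
  (p : hom X Y) (F : functor C (slice X)) :
  has_pullbacks C -> terminal one ->
  has_right_adjoint (functor_comp (Sigma p) F) -> has_right_adjoint F.
Proof.
intros pb term; rewrite !has_right_adjoint_couniversal; intros HR k.
set (T := functor_comp (Sigma p) F) in *.
destruct (HR (Sigma p k)) as [RK [epsK HK]], (HR (SliceOb p)) as [Rp [epsp Hp]].
destruct (Hp RK (Sigma_proj p k ∘ epsK)) as [r [er _]].
destruct (Hp one (Sigma_proj p (F one))) as [t [et _]].
assert (t_proj : forall A (b : hom A one),
  epsp ∘ fmap T (t ∘ b) = Sigma_proj p (F A)).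
{ intros A b; rewrite fmap_comp, comp_assoc, et; apply Sigma_proj_natural. }
destruct (pb _ _ _ r t) as [s Hs].
destruct (Sigma_lift _ _ _ p (F (apex s)) k (epsK ∘ fmap T (pr1 s)))
  as [eps eps_eq].
{ rewrite comp_assoc, <- er, <- comp_assoc, <- fmap_comp, (square_comm s).
  apply t_proj. }
assert (eps_iff : forall A (w : hom A (apex s)) (u : hom (F A) k),
  epsK ∘ fmap T (pr1 s ∘ w) = fmap (Sigma p) u <-> eps ∘ fmap F w = u).
{ intros A w u.
  assert (e : fmap (Sigma p) (eps ∘ fmap F w) = epsK ∘ fmap T (pr1 s ∘ w)).
  { now rewrite !fmap_comp, eps_eq, comp_assoc. }
  rewrite <- e; split; [apply Sigma_faithful|now intros ->]. }
exists (apex s), eps; intros A u.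
destruct (HK A (fmap (Sigma p) u)) as [v [ev vu]], (term A) as [b [_ bu]].
assert (vb : r ∘ v = t ∘ b).
{ apply (couniversal_inj _ _ _ _ _ _ Hp); rewrite t_proj, fmap_comp, comp_assoc, er, <- comp_assoc, ev.
  apply Sigma_proj_natural. }
destruct (Hs A v b vb) as [w [[w1 w2] wu]].
exists w; split.
- apply eps_iff; now rewrite w1.
- intros w' e; apply wu; split.
  + symmetry; apply vu; now apply eps_iff.
  + symmetry; now apply bu.
Qed.

Theorem proposition4p4p1 (E : category) (S : locally_subcartesian E)
  (pullbacks : has_pullbacks E) :
  locally_subcartesian_closed S <->
  (forall (X Y : E) (p : hom X Y), has_right_adjoint (nabla S p)).
Proof.
split.
- intros closed X Y p.
  apply (has_right_adjoint_of_Sigma_comp _ _ _ _ _ p _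
    (slice_has_pullbacks _ _ pullbacks) (slice_terminal _ _)).
  exact (closed Y (SliceOb p)).
- intros boxtimes X g; apply has_right_adjoint_comp.
  + now apply Sigma_has_right_adjoint.
  + apply boxtimes.
Qed.
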